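(* There exist a constant $\gamma \geq 0.002$ and a number $n_0$ such that for every integer $n > n_0$, $$S(n) < n^{1/2} + n^{1/4}(1-\gamma),$$ where $S(n)$ denotes the maximum cardinality of a Sidon set $A \subseteq \{1,2,\dots,n\}$.
   Context: A set of integers $A$ is a Sidon set if whenever $a+b=c+d$ with $a,b,c,d\in A$, then $\{a,b\}=\{c,d\}$ (i.e., all sums $a+b$ with $a,b\in A$ are distinct up to reordering of the summands). For a positive integer $n$, $S(n)$ is the maximum size of a Sidon set contained in $[n]=\{1,2,\dots,n\}$. *)

(* Defs.v *)
From HB Require Import structures.
From mathcomp Require Export all_boot all_order all_algebra finmap.
From mathcomp Require Export all_classical all_reals all_analysis.

Set Implicit Arguments.
Unset Strict Implicit.
Unset Printing Implicit Defensive.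

Import GRing.Theory.
Local Open Scope classical_set_scope.
Local Open Scope ring_scope.

Definition is_sidon (A : set int) : Prop :=
  forall a b c d : int, A a -> A b -> A c -> A d ->
    a + b = c + d -> [set a; b] = [set c; d].

Definition interval1 (n : nat) : {fset int} :=
  [fset (Posz k) | k in iota 1 n]%fset.

Definition sidon_max (n : nat) : nat :=
  (\max_(A <- fpowerset (interval1 n) | `[< is_sidon [set` A] >]) #|` A|)%N.

Lemma mem_interval1 (n : nat) (x : int) :
  (x \in interval1 n) = (1 <= x <= n%:Z).
Proof.
apply/idP/idP => [/imfsetP[k /=]|].
  by rewrite mem_iota add1n ltnS => /andP[k1 kn] ->; rewrite !lez_nat k1 kn.
case: x => // k; rewrite !lez_nat => k1n; apply/imfsetP; exists k => //=.
by rewrite mem_iota add1n ltnS.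
Qed.

Lemma sidon_max_ub (n : nat) (A : {fset int}) :
  (A `<=` interval1 n)%fset -> is_sidon [set` A] ->
  (#|` A| <= sidon_max n)%N.
Proof.
move=> An As; rewrite /sidon_max.
apply: (@leq_bigmax_seq _ _ _ (fun A : {fset int} => #|` A|)).
  by rewrite fpowersetE.
exact/asboolP.
Qed.

Lemma sidon_max_attained (n : nat) :
  exists A : {fset int}, [/\ (A `<=` interval1 n)%fset, is_sidon [set` A]
    & #|` A| = sidon_max n].
Proof.
rewrite /sidon_max big_seq_cond.
elim/big_rec: _ => [|B m /andP[+ /asboolP sB] [C [Cn sC <-]]].
  exists fset0; split; [exact: fsub0set|by move=> a b c d; rewrite /= inE|].
  exact: cardfs0.
rewrite fpowersetE => Bn.
by rewrite /maxn; case: ifP => _; [exists C | exists B].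
Qed.

(* Main.v *)
Require Import Defs.
From mathcomp Require Import zify ring lra.

Set Implicit Arguments.
Unset Strict Implicit.
Unset Printing Implicit Defensive.

Import Order.TTheory GRing.Theory Num.Theory.
Local Open Scope ring_scope.

(** The positive differences of a Sidon set are distinct.  Hence, if one counts
    the elements of [A], [|A| = k], in all windows of length [u], the sum over
    the windows of the squared deviation of the count from [c u] is an explicit
    polynomial minus twice a sum over the differences that [A] misses.  For
    [u = x n^(3/4)], [c = n^(-1/2)] and [k = n^(1/2) + t n^(1/4)] the polynomial
    is [P(x) = x - 2 t x^2 + x^3] times [n^(5/4)], up to lower order terms.
    [P(1) >= 0] already is the Erdos-Turan bound [t <= 1].  To gain a constant,
    write a window of length [w] as the difference of windows of lengths [v + w]
    and [v]: the squared deviation at [w] is at most about twice the sum of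
    those at [v + w] and [v], and this passes to the polynomials because the
    missing differences contribute more at [v + w] than at [w].  Thus
    [P(1/4) <= 2 (P(1) + P(3/4))] up to lower order terms, whereas at [t = 1]
    the left side is 9/64 and the right side 6/64; in fact
    [t <= 389/392 + o(1)]. *)

Section Windows.
Local Open Scope nat_scope.

Lemma sum1_ord_itv (T a b : nat) : b <= T ->
  \sum_(e < T | a <= e < b) 1 = b - a.
Proof.
move=> bT; rewrite -[RHS]muln1 -sum_nat_const_nat (big_nat_widen _ _ _ _ _ bT).
by rewrite big_geq_mkord; apply: eq_bigl => e; rewrite /= andbC.
Qed.

Variable n : nat.
Implicit Types (A : {set 'I_n}) (p : 'I_n * 'I_n).

Definition ordered_pairs A : {set 'I_n * 'I_n} :=
  [set p | [&& p.1 \in A, p.2 \in A & p.1 < p.2]].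

Definition gap p : nat := p.2 - p.1.

Lemma mem_ordered_pairs A p :
  (p \in ordered_pairs A) = [&& p.1 \in A, p.2 \in A & p.1 < p.2].
Proof. by rewrite inE. Qed.

Lemma card_sqr_ordered_pairs A : #|A| ^ 2 = #|A| + 2 * #|ordered_pairs A|.
Proof.
rewrite -mulnn -cardsX -sum1_card (bigID (fun p => p.1 < p.2)) /=.
rewrite addnC [in LHS](bigID (fun p => p.2 < p.1)) /=.
rewrite mul2n -addnn addnCA -addnA.
congr (_ + (_ + _)).
- rewrite (reindex_inj (can_inj swap_pairK)) -sum1_card; apply: eq_bigl => p.
  by rewrite mem_ordered_pairs inE /=; lia.
- rewrite -(card_imset A (f := fun x => (x, x))) => [|x y []] //.
  rewrite -sum1_card; apply: eq_bigl => -[x y] /=; rewrite inE /= -!leqNgt.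
  apply/idP/imsetP => [xy|[z Az [-> ->]]]; last by rewrite Az leqnn.
  by exists x; [lia | congr pair; apply: val_inj => /=; lia].
- rewrite -sum1_card; apply: eq_bigl => p.
  by rewrite mem_ordered_pairs inE andbA.
Qed.

(* Windows are indexed by their right end, so that those of length [u] meeting
   ['I_n] are exactly the ones with index below [n + u - 1]. *)
Definition window A (u e : nat) : {set 'I_n} := [set x in A | x <= e < x + u].

Lemma card_windowD A u v e :
  #|window A (u + v) (e + u)| = #|window A u (e + u)| + #|window A v e|.
Proof.
rewrite -[LHS](cardsID (window A v e)) addnC.
congr addn; congr #|pred_of_set _|.
  by apply/setP=> x; rewrite !inE; case: (x \in A) => //=; lia.
by apply/setP=> x; rewrite !inE; case: (x \in A) => //=; lia.
Qed.

Lemma sum_card_window A u :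
  \sum_(e < (n + u).-1) #|window A u e| = u * #|A|.
Proof.
rewrite (eq_bigr _ (fun e _ => esym (sum1_card _))).
rewrite (exchange_big_dep (mem A)) /= => [|e x _]; last first.
  by rewrite inE => /andP[].
rewrite mulnC -sum_nat_const; apply: eq_bigr => x Ax.
under eq_bigl do rewrite inE Ax.
by rewrite sum1_ord_itv ?addKn //; have := ltn_ord x; lia.
Qed.

Lemma sum_card_window_pairs A u :
  \sum_(e < (n + u).-1) #|ordered_pairs (window A u e)| =
  \sum_(p in ordered_pairs A) (u - gap p).
Proof.
rewrite (eq_bigr _ (fun e _ => esym (sum1_card _))).
rewrite (exchange_big_dep (mem (ordered_pairs A))) /= => [|e p _]; last first.
  by rewrite !mem_ordered_pairs !inE => /and3P[/andP[-> _] /andP[-> _] ->].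
apply: eq_bigr => p; rewrite mem_ordered_pairs => /and3P[Ap1 Ap2 p12].
rewrite (eq_bigl (fun e : 'I__ => p.2 <= e < p.1 + u)) => [|e]; last first.
  by rewrite mem_ordered_pairs !inE Ap1 Ap2; lia.
rewrite sum1_ord_itv /gap; first by lia.
by have := ltn_ord p.1; lia.
Qed.

Definition golomb A : Prop := {in ordered_pairs A &, injective gap}.

Definition gaps A : seq nat := [seq gap p | p in ordered_pairs A].

Definition missing_gaps A (u : nat) : nat :=
  \sum_(1 <= d < u | d \notin gaps A) (u - d).

Lemma leq_missing_gaps A u v : u <= v -> missing_gaps A u <= missing_gaps A v.
Proof.
move=> uv; rewrite /missing_gaps (big_nat_widen _ _ _ _ _ uv).
rewrite big_mkcond [leqRHS]big_mkcond; apply: leq_sum => d _ /=.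
by case: (d \notin _) => //=; case: ifP => // _; rewrite leq_sub2r.
Qed.

Lemma sum_subn_bin2 u : \sum_(1 <= d < u) (u - d) = 'C(u, 2).
Proof.
rewrite -bin2_sum; case: u => [|u]; first by rewrite !big_geq.
rewrite [RHS]big_ltn // add0n big_nat_rev.
by apply: eq_big_nat => d /andP[d0 du]; lia.
Qed.

Lemma sum_golomb_gaps A u : golomb A ->
  \sum_(p in ordered_pairs A) (u - gap p) + missing_gaps A u = 'C(u, 2).
Proof.
move=> golombA.
have gaps_uniq : uniq (gaps A).
  rewrite map_inj_in_uniq ?enum_uniq // => p p' pA p'A.
  by apply: golombA; rewrite -mem_enum.
rewrite -sum_subn_bin2 (bigID (mem (gaps A))) /=; congr (_ + _).
rewrite -(big_enum _ _ _ (fun p => u - gap p)) -(big_map gap xpredT (subn u)).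
rewrite (bigID (fun d => d < u)) /= [X in _ + X]big1 ?addn0; last first.
  by move=> d; rewrite -leqNgt => ud; apply/eqP.
rewrite -big_filter -[RHS]big_filter; apply: perm_big.
apply: uniq_perm; rewrite ?filter_uniq ?iota_uniq // => d.
rewrite !mem_filter mem_index_iota.
case dA: (d \in gaps A) => /=; rewrite ?andbF // ?andbT.
have /mapP[p] := dA; rewrite mem_enum mem_ordered_pairs => /and3P[_ _ p12] ->.
by rewrite /gap; lia.
Qed.

Lemma sum_sqr_card_window A u : golomb A ->
  \sum_(e < (n + u).-1) #|window A u e| ^ 2 + 2 * missing_gaps A u =
  u * #|A| + u * u.-1.
Proof.
move=> golombA; under eq_bigr do rewrite card_sqr_ordered_pairs.
rewrite big_split /= -big_distrr /= sum_card_window sum_card_window_pairs.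
rewrite -addnA -mulnDr sum_golomb_gaps //; congr (_ + _).
by case: u => // u; rewrite -mul_bin_diag bin1.
Qed.

End Windows.

Lemma ler_sqrB (R : realDomainType) (x y : R) :
  (x - y) ^+ 2 <= 2 * (x ^+ 2 + y ^+ 2).
Proof. by have := sqr_ge0 (x + y); rewrite sqrrD sqrrB; lra. Qed.

Lemma ler_sum_shift (R : numDomainType) (g : nat -> R) (N M k : nat) :
  (forall e, 0 <= g e) -> (forall e, (M <= e < N + k)%N -> g e = 0) ->
  \sum_(e < N) g (e + k)%N <= \sum_(e < M) g e.
Proof.
move=> g0 gM; apply: (@le_trans _ _ (\sum_(e < k + N) g e)).
  rewrite big_split_ord /= [leLHS](_ : _ = \sum_(e < N) g (k + e)%N).
    by rewrite lerDr sumr_ge0.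
  by under eq_bigr do rewrite addnC.
have [kNM|MkN] := leqP (k + N) M.
  by rewrite -(subnKC kNM) [leRHS]big_split_ord /= lerDl sumr_ge0.
rewrite -(subnKC (ltnW MkN)) big_split_ord /= [X in _ + X]big1 ?addr0 // => e _.
by apply: gM; have := ltn_ord e; lia.
Qed.

Section Variance.
Variables (R : realFieldType) (n : nat) (A : {set 'I_n}) (c : R).

Definition deviation (u e : nat) : R := #|window A u e|%:R - c * u%:R.

Definition sqr_deviation (u : nat) : R :=
  \sum_(e < (n + u).-1) deviation u e ^+ 2.

(* The value that [sqr_deviation u] would have for a set of [k] elements of
   ['I_N] in which every difference below [u] occurs. *)
Definition full_sqr_deviation (N k u : R) : R :=
  u * k + u ^+ 2 - u - 2 * c * u ^+ 2 * k + c ^+ 2 * u ^+ 2 * (N + u - 1).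

Lemma sqr_deviationE u : golomb A -> (0 < u)%N ->
  sqr_deviation u =
  full_sqr_deviation n%:R #|A|%:R u%:R - 2 * (missing_gaps A u)%:R.
Proof.
move=> golombA u0.
have natr_pred m : (0 < m)%N -> m.-1%:R = m%:R - 1 :> R.
  by case: m => // m _; rewrite -natr1 addrK.
have sum_count : \sum_(e < (n + u).-1) #|window A u e|%:R = u%:R * #|A|%:R :> R.
  by rewrite -natr_sum sum_card_window natrM.
have := congr1 (GRing.natmul (1 : R)) (sum_sqr_card_window u golombA).
rewrite natrD !natrM natrD !natrM natr_pred // natr_sum => sum_sqr_count.
rewrite /sqr_deviation /full_sqr_deviation /deviation.
under eq_bigr => e _ do rewrite sqrrB -natrX -mulrnAr mulrC.
rewrite big_split sumrB /= -mulr_sumr sum_count sumr_const card_ord.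
by rewrite -[_ *+ (n + u).-1]mulr_natr natr_pred ?natrD; [lra | lia].
Qed.

Lemma deviation_extendr v w e :
  deviation w e = deviation (v + w) (e + v) - deviation v (e + v).
Proof. by rewrite /deviation card_windowD !natrD; ring. Qed.

Lemma deviation_extendl v w e :
  deviation w (e + w) = deviation (v + w) (e + w) - deviation v e.
Proof. by rewrite /deviation [(v + w)%N]addnC card_windowD !natrD; ring. Qed.

Section Comparison.
Variables v w : nat.
Hypothesis wn : (w < n)%N.

Lemma ler_weighted_extendr (p : nat -> R) : (forall e, 0 <= p e) ->
    (forall e, (n.-1 <= e)%N -> p e = 0) ->
  \sum_(e < (n + w).-1) p e * deviation w e ^+ 2 <=
  2 * (\sum_(e < (n + (v + w)).-1) p (e - v)%N * deviation (v + w) e ^+ 2 +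
       \sum_(e < (n + v).-1) p (e - v)%N * deviation v e ^+ 2).
Proof.
move=> p0 pn; pose term u e := p (e - v)%N * deviation u e ^+ 2.
have term0 u e : 0 <= term u e by rewrite mulr_ge0 ?sqr_ge0.
apply: (@le_trans _ _ (\sum_(e < (n + w).-1)
    2 * (term (v + w)%N (e + v)%N + term v (e + v)%N))).
  apply: ler_sum => e _; rewrite /term addnK -mulrDr [leRHS]mulrCA.
  by rewrite (deviation_extendr v) ler_wpM2l ?ler_sqrB.
rewrite -mulr_sumr big_split /= ler_pM2l // lerD //;
  by apply: ler_sum_shift => // e ?; rewrite /term pn ?mul0r //; lia.
Qed.

Lemma ler_weighted_extendl (p : nat -> R) : (forall e, 0 <= p e) ->
    (forall e, (e < w)%N -> p e = 0) ->
  \sum_(e < (n + w).-1) p e * deviation w e ^+ 2 <=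
  2 * (\sum_(e < (n + (v + w)).-1) p e * deviation (v + w) e ^+ 2 +
       \sum_(e < (n + v).-1) p (e + w)%N * deviation v e ^+ 2).
Proof.
move=> p0 pw; pose long e := p e * deviation (v + w) e ^+ 2.
pose rest e := p (e + w)%N * deviation v e ^+ 2.
have long0 e : 0 <= long e by rewrite mulr_ge0 ?sqr_ge0.
rewrite (_ : (n + w).-1 = w + n.-1)%N; last by lia.
rewrite big_split_ord /= big1 ?add0r => [|e _]; last by rewrite pw ?mul0r.
apply: (@le_trans _ _ (\sum_(e < n.-1) 2 * (long (e + w)%N + rest e))).
  apply: ler_sum => e _; rewrite /long /rest -mulrDr [leRHS]mulrCA addnC.
  by rewrite (deviation_extendl v) ler_wpM2l ?ler_sqrB.
rewrite -mulr_sumr big_split /= ler_pM2l // lerD //.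
  by apply: (ler_sum_shift long0) => e; lia.
rewrite (_ : (n + v).-1 = n.-1 + v)%N; last by lia.
by rewrite big_split_ord /= lerDl sumr_ge0 // => e _; rewrite mulr_ge0 ?sqr_ge0.
Qed.

(* The extension to the right (left) of a window at the right (left) end of
   ['I_n] misses ['I_n].  Averaging both extensions with weights that vanish
   there costs only the factor [(n + v) / (n - w)]. *)
Lemma ler_sqr_deviation :
  (n - w)%:R * sqr_deviation w <=
  2 * (n + v)%:R * (sqr_deviation (v + w) + sqr_deviation v).
Proof.
pose rweight e := minn (n - w) (n.-1 - e).
pose lweight e := minn (n - w) (e.+1 - w).
have right := @ler_weighted_extendr (fun e => (rweight e)%:R) (fun=> ler0n _ _).
have left := @ler_weighted_extendl (fun e => (lweight e)%:R) (fun=> ler0n _ _).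
have -> : (n - w)%:R * sqr_deviation w =
    \sum_(e < (n + w).-1) (rweight e)%:R * deviation w e ^+ 2 +
    \sum_(e < (n + w).-1) (lweight e)%:R * deviation w e ^+ 2.
  rewrite -big_split mulr_sumr; apply: eq_bigr => e _ /=.
  by rewrite -mulrDl -natrD; congr (_%:R * _); rewrite /lweight /rweight; lia.
apply: (le_trans (lerD (right _) (left _))) => [e ne|e ew|].
- by rewrite (_ : rweight e = 0%N) // /rweight; lia.
- by rewrite (_ : lweight e = 0%N) // /lweight; lia.
have sum_weights (f : nat -> R) (p q : nat -> nat) N :
    (forall e, p e + q e <= n + v)%N ->
    \sum_(e < N) (p e)%:R * f e ^+ 2 + \sum_(e < N) (q e)%:R * f e ^+ 2 <=
    (n + v)%:R * \sum_(e < N) f e ^+ 2.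
  move=> pq; rewrite -big_split mulr_sumr; apply: ler_sum => e _ /=.
  by rewrite -mulrDl -natrD ler_wpM2r ?sqr_ge0 // ler_nat.
rewrite -mulrDr addrACA -mulrA ler_pM2l // mulrDr.
pose shifted_rweight e := rweight (e - v)%N.
apply: lerD.
  apply: (sum_weights _ shifted_rweight lweight) => e.
  by rewrite /shifted_rweight /lweight /rweight; lia.
apply: (sum_weights _ shifted_rweight (fun e => lweight (e + w)%N)) => e.
by rewrite /shifted_rweight /lweight /rweight; lia.
Qed.

Lemma ler_full_sqr_deviation : golomb A -> (0 < v)%N -> (0 < w)%N ->
  (n - w)%:R * full_sqr_deviation n%:R #|A|%:R w%:R <=
  2 * (n + v)%:R * (full_sqr_deviation n%:R #|A|%:R (v + w)%:R +
                    full_sqr_deviation n%:R #|A|%:R v%:R).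
Proof.
move=> golombA v0 w0; have := ler_sqr_deviation.
rewrite !sqr_deviationE // ?addn_gt0 ?v0 //.
have : (n - w)%:R * (missing_gaps A w)%:R <=
    (n + v)%:R * (missing_gaps A (v + w))%:R :> R.
  by rewrite -!natrM ler_nat leq_mul ?leq_missing_gaps //; lia.
have : 0 <= (n + v)%:R * (missing_gaps A (v + w))%:R :> R by rewrite mulr_ge0.
have : 0 <= (n + v)%:R * (missing_gaps A v)%:R :> R by rewrite mulr_ge0.
lra.
Qed.

End Comparison.
End Variance.

Section Asymptotics.
Variable R : realFieldType.

Definition scaled_deviation (e t x : R) : R :=
  x * (1 + t * e) - 2 * t * x ^+ 2 + x ^+ 3 - x ^+ 2 * e ^+ 3 - x * e ^+ 2.

Lemma full_sqr_deviation_scale (q t x : R) : q != 0 ->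
  full_sqr_deviation (q ^- 2) (q ^+ 4) (q ^+ 2 + t * q) (x * q ^+ 3) =
  q ^+ 5 * scaled_deviation q^-1 t x.
Proof. by move=> q0; rewrite /full_sqr_deviation /scaled_deviation; field. Qed.

Section Gap.
Variables e s t : R.
Hypotheses (e_itv : 0 < e <= 1 / 1000) (s_itv : 249 / 1000 <= s <= 1 / 4).
Hypothesis t_ge : 499 / 500 <= t.

Let t_excess : 0 <= t - 499 / 500. Proof. by rewrite subr_ge0. Qed.

(* At [e = 0], [s = 1 / 4] and [t = 499 / 500] the left side is 0.0531 and
   [scaled_deviation e t s] is 0.1408; the bounds 0.063 and 0.138 below leave
   room for the variation of [e] and [s]. *)
Lemma scaled_deviation_long_le :
  scaled_deviation e t (4 * s) + scaled_deviation e t (3 * s) <=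
  63 / 1000 - 3 * (t - 499 / 500).
Proof.
have [/andP[e_gt0 e_le] /andP[s_ge s_le]] := (e_itv, s_itv).
have sqr_s : 249 / 1000 * s <= s ^+ 2 by rewrite expr2; nra.
have cube_s : s ^+ 3 <= s ^+ 2 / 4.
  by rewrite exprS mulrC ler_wpM2l ?sqr_ge0 //; lra.
have se : s * e <= 1 / 4000 by nra.
have t_coef : 3 <= 50 * s ^+ 2 - 7 * (s * e) by lra.
have se2 : 0 <= s * e ^+ 2 by nra.
have s2e3 : 0 <= s ^+ 2 * e ^+ 3 by rewrite mulr_ge0 ?sqr_ge0 // exprn_ge0; lra.
have := ler_wpM2r t_excess t_coef; rewrite /scaled_deviation; lra.
Qed.

Lemma scaled_deviation_short_ge :
  69 / 500 - (t - 499 / 500) / 4 <= scaled_deviation e t s.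
Proof.
have [/andP[e_gt0 e_le] /andP[s_ge s_le]] := (e_itv, s_itv).
have sqr_s : s ^+ 2 <= s / 4 by rewrite expr2; nra.
have cube_s : 15 / 1000 <= s ^+ 3.
  by have := @lerXn2r _ 3 (249 / 1000) s; rewrite !nnegrE => /(_ _ _ s_ge); lra.
have se : 0 <= s * e by nra.
have sqr_e : e ^+ 2 <= e / 1000 by rewrite expr2; nra.
have cube_e : e ^+ 3 <= e ^+ 2 by rewrite exprS ler_piMl ?sqr_ge0 //; lra.
have se2 : s * e ^+ 2 <= e / 1000 by nra.
have s2e3 : s ^+ 2 * e ^+ 3 <= e / 1000 by nra.
have t_coef : - (1 / 4) <= s * e - 2 * s ^+ 2 by lra.
have := ler_wpM2r t_excess t_coef; rewrite /scaled_deviation; lra.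
Qed.

Lemma scaled_deviation_gap :
  2 * (1 + 3 * s * e) *
    (scaled_deviation e t (4 * s) + scaled_deviation e t (3 * s)) <
  (1 - s * e) * scaled_deviation e t s.
Proof.
have [/andP[e_gt0 e_le] /andP[s_ge s_le]] := (e_itv, s_itv).
have se_ge0 : 0 <= s * e by nra.
have se_le : s * e <= 1 / 1000 by nra.
have := scaled_deviation_long_le; have := scaled_deviation_short_ge.
move: (scaled_deviation e t s) (_ + scaled_deviation _ _ _) (t - _) t_excess
  => short long d d_ge0 short_ge long_le.
have sed_ge0 : 0 <= s * e * d by rewrite mulr_ge0.
apply: (@le_lt_trans _ _ (2 * (1 + 3 * s * e) * (63 / 1000 - 3 * d))).
  by apply: ler_wpM2l long_le; lra.
apply: (@lt_le_trans _ _ ((1 - s * e) * (69 / 500 - d / 4))); first by lra.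
by apply: ler_wpM2l short_ge; lra.
Qed.

End Gap.
End Asymptotics.

Lemma ler_scaled_deviation (R : realFieldType) (n : nat) (A : {set 'I_n})
    (v w : nat) (q s t x : R) :
  golomb A -> (0 < v)%N -> (0 < w < n)%N -> 0 < q -> n%:R = q ^+ 4 ->
  #|A|%:R = q ^+ 2 + t * q -> v%:R = x * q ^+ 3 -> w%:R = s * q ^+ 3 ->
  (1 - s * q^-1) * scaled_deviation q^-1 t s <=
  2 * (1 + x * q^-1) *
    (scaled_deviation q^-1 t (x + s) + scaled_deviation q^-1 t x).
Proof.
move=> golombA v0 /andP[w0 wn] q0 nq AE vE wE.
have qN0 : q != 0 by rewrite gt_eqF.
have nB : (n - w)%:R = q ^+ 4 * (1 - s * q^-1).
  by rewrite natrB ?(ltnW wn) // nq wE; field.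
have nD : (n + v)%:R = q ^+ 4 * (1 + x * q^-1) by rewrite natrD nq vE; field.
have vwE : (v + w)%:R = (x + s) * q ^+ 3 by rewrite natrD vE wE mulrDl.
have := ler_full_sqr_deviation (q ^- 2) wn golombA v0 w0.
rewrite nB nD vwE vE wE nq AE !full_sqr_deviation_scale // -mulrDr.
rewrite [2 * (q ^+ 4 * _)]mulrCA mulrACA [leRHS]mulrACA.
by rewrite ler_pM2l ?mulr_gt0 ?exprn_gt0.
Qed.

Lemma golomb_card_lt (R : archiRealFieldType) (n : nat) (A : {set 'I_n})
    (q : R) :
  golomb A -> 1000 <= q -> n%:R = q ^+ 4 ->
  #|A|%:R < q ^+ 2 + 499 / 500 * q.
Proof.
move=> golombA q_ge nq; rewrite ltNge; apply/negP => A_ge.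
have q1 : 1 <= q by lra.
have q0 : 0 < q by lra.
have q3 : 1000 <= q ^+ 3 by apply: le_trans q_ge (ler_eXnr _ q1).
have q4 : q ^+ 3 <= q ^+ 4 by apply: ler_weXn2l.
have q3N0 : q ^+ 3 != 0 by rewrite gt_eqF ?exprn_gt0.
pose w := Num.truncn (q ^+ 3 / 4); pose s := w%:R / q ^+ 3.
have /andP[w_le w_gt] : w%:R <= q ^+ 3 / 4 < w.+1%:R.
  by apply: truncn_itv; lra.
rewrite -[w.+1%:R]natr1 in w_gt.
have w0 : (0 < w)%N by rewrite -(ltr_nat R); lra.
have wn : (w < n)%N by rewrite -(ltr_nat R) nq; lra.
pose t := (#|A|%:R - q ^+ 2) / q.
have AE : #|A|%:R = q ^+ 2 + t * q by rewrite divfK ?subrKC ?gt_eqF.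
have wE : w%:R = s * q ^+ 3 by rewrite divfK.
have vE : (3 * w)%:R = 3 * s * q ^+ 3 by rewrite natrM wE mulrA.
have := ler_scaled_deviation golombA _ _ q0 nq AE vE wE.
rewrite muln_gt0 w0 wn => /(_ isT isT); apply/negP; rewrite -ltNge.
rewrite (_ : 3 * s + s = 4 * s); last by ring.
apply: scaled_deviation_gap.
- by rewrite invr_gt0 q0 -[q^-1]div1r ler_pdivrMr //; lra.
- by rewrite /s ler_pdivlMr ?ler_pdivrMr ?exprn_gt0 //; lra.
- by rewrite /t ler_pdivlMr //; lra.
Qed.

Section SidonPositions.
Variables (n : nat) (A : {fset int}).

Definition positions : {set 'I_n} := [set i : 'I_n | i.+1%:Z \in A].

Lemma card_positions : (A `<=` interval1 n)%fset -> #|positions| = #|` A|.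
Proof.
move=> /fsubsetP An; pose f (i : 'I_n) := i.+1%:Z.
have f_inj : injective f by move=> i j [/val_inj].
rewrite cardE -(size_map f); apply/perm_size/uniq_perm.
- by rewrite map_inj_uniq ?enum_uniq.
- exact: fset_uniq.
move=> x; apply/mapP/idP => [[i]|Ax]; first by rewrite mem_enum inE => ? ->.
have := An x Ax; rewrite mem_interval1 => x1n.
have xn : (`|x|%N.-1 < n)%N by lia.
have xE : x = f (Ordinal xn) by rewrite /f /=; lia.
by exists (Ordinal xn) => //; rewrite mem_enum inE -/(f _) -xE.
Qed.

Lemma golomb_positions : is_sidon [set` A]%classic -> golomb positions.
Proof.
move=> sidonA [x y] [z t]; rewrite !mem_ordered_pairs !inE /gap /=.
move=> /and3P[Ax Ay xy] /and3P[Az At zt] yx_tz.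
have /(congr1 (fun B : set int => B y.+1%:Z)) :
    [set y.+1%:Z; z.+1%:Z]%classic = [set t.+1%:Z; x.+1%:Z]%classic.
  by apply: sidonA => //; lia.
rewrite propeqE => -[/(_ (or_introl erefl)) /= yE _].
by congr pair; apply: val_inj => /=; case: yE; lia.
Qed.

End SidonPositions.

Lemma powRX (R : realType) (x r : R) (k : nat) :
  (x `^ r) ^+ k = x `^ (r * k%:R).
Proof. by rewrite powRrM powR_mulrn ?powR_ge0. Qed.

Theorem theorem1p1 (R : realType) :
  exists gamma : R, 2 / 1000 <= gamma /\
  exists n0 : nat, forall n : nat, (n0 < n)%N ->
    (sidon_max n)%:R < n%:R `^ (1 / 2) + n%:R `^ (1 / 4) * (1 - gamma).
Proof.
exists (2 / 1000); split=> //; exists (Num.truncn (1000 ^+ 4 : R)) => n.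
rewrite truncn_lt_nat ?exprn_ge0 ?ler0n // => n_gt.
have [A [An sidonA <-]] := sidon_max_attained n; rewrite -(card_positions An).
pose q : R := n%:R `^ (1 / 4).
have q4 : n%:R = q ^+ 4 by rewrite powRX mulrVK ?unitfE // powRr1.
have q2 : n%:R `^ (1 / 2) = q ^+ 2 by rewrite powRX; congr (_ `^ _); field.
have q_ge : 1000 <= q.
  rewrite q4 in n_gt; apply/ltW; move: n_gt.
  by rewrite (@ltr_pXn2r R 4 isT) ?nnegrE ?powR_ge0 ?ler0n.
rewrite q2 -/q (_ : q * (1 - 2 / 1000) = 499 / 500 * q); last by field.
exact: golomb_card_lt (golomb_positions sidonA) q_ge q4.
Qed.
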